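(* Let $\mathcal{A}$ be a category with two bifunctors $\oplus,\otimes:\mathcal{A}\times\mathcal{A}\to\mathcal{A}$. Then $\mathcal{A}$ is a symmetric Ann-category (i.e. $(\mathcal{A},\oplus,\otimes)$ carries the structure of one) if and only if the following conditions are satisfied: (i) There are an object $0\in\mathcal{A}$ and natural isomorphisms $a^+,c^+,g,d$ such that $(\mathcal{A},\oplus,a^+,c^+,(0,g,d))$ is a symmetric categorical group. (ii) There are an object $1\in\mathcal{A}$ and natural isomorphisms $a,c,l,r$ such that $(\mathcal{A},\otimes,a,c,(1,l,r))$ is a symmetric monoidal category. (iii) There is a natural isomorphism $\mathfrak{L}_{A,X,Y}:A\otimes(X\oplus Y)\to(A\otimes X)\oplus(A\otimes Y)$ such that, for each $A$, the functor $L^A=A\otimes-$ with $\breve{L}^A_{X,Y}=\mathfrak{L}_{A,X,Y}$ is an $\oplus$-functor compatible with $a^+$ and $c^+$, and such that, for all objects (writing $AB$ for $A\otimes B$), (1) $\mathfrak{L}_{AB,X,Y}\circ a_{A,B,X\oplus Y}=(a_{A,B,X}\oplus a_{A,B,Y})\circ\mathfrak{L}_{A,BX,BY}\circ(\mathrm{id}_A\otimes\mathfrak{L}_{B,X,Y})$; (5.1) $(l_X\oplus l_Y)\circ\mathfrak{L}_{1,X,Y}=l_{X\oplus Y}$; (8) $(\mathfrak{L}_{X,A,B}\oplus\mathfrak{L}_{Y,A,B})\circ(c_{A\oplus B,X}\oplus c_{A\oplus B,Y})\circ\mathfrak{L}_{A\oplus B,X,Y}\circ c_{X\oplus Y,A\oplus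 B}$ $=\big((c_{A,X}\oplus c_{B,X})\oplus(c_{A,Y}\oplus c_{B,Y})\big)\circ v_{AX,AY,BX,BY}\circ(\mathfrak{L}_{A,X,Y}\oplus\mathfrak{L}_{B,X,Y})\circ(c_{X\oplus Y,A}\oplus c_{X\oplus Y,B})\circ\mathfrak{L}_{X\oplus Y,A,B}$ as morphisms $(X\oplus Y)(A\oplus B)\to(XA\oplus XB)\oplus(YA\oplus YB)$.
   Context: Write $AB$ for $A\otimes B$; $v_{U,V,Z,T}:(U\oplus V)\oplus(Z\oplus T)\to(U\oplus Z)\oplus(V\oplus T)$ is the canonical isomorphism built from $a^+,c^+,\mathrm{id}$ (interchanging $V$ and $Z$). A symmetric categorical group is a symmetric monoidal category that is a groupoid and in which every object $X$ has an object $X'$ with $X\oplus X'\cong 0$. Directions: $a^+_{X,Y,Z}:X\oplus(Y\oplus Z)\to(X\oplus Y)\oplus Z$, $c^+_{X,Y}:X\oplus Y\to Y\oplus X$, $g_X:0\oplus X\to X$, $d_X:X\oplus0\to X$, $a_{A,B,C}:A(BC)\to(AB)C$, $c_{A,B}:AB\to BA$, $l_X:1X\to X$, $r_X:X1\to X$. Compatibility of $(L^A,\breve L^A)$ with $a^+$ and $c^+$ means $(\mathfrak{L}_{A,X,Y}\oplus \mathrm{id})\mathfrak{L}_{A,X\oplus Y,Z}(\mathrm{id}_A\otimes a^+_{X,Y,Z})=a^+_{AX,AY,AZ}(\mathrm{id}\oplus\mathfrak{L}_{A,Y,Z})\mathfrak{L}_{A,X,Y\oplus Z}$ and $c^+_{AX,AY}\mathfrak{L}_{A,X,Y}=\mathfrak{L}_{A,Y,X}(\mathrm{id}_A\otimes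 c^+_{X,Y})$. A symmetric Ann-category consists of a category $\mathcal{A}$ with bifunctors $\oplus,\otimes$, data $(0,a^+,c^+,g,d)$ making $(\mathcal{A},\oplus)$ a symmetric categorical group, data $(1,a,c,l,r)$ making $(\mathcal{A},\otimes)$ a symmetric monoidal category with $c_{0,0}=\mathrm{id}$, and natural isomorphisms $\mathfrak{L}_{A,X,Y}:A(X\oplus Y)\to AX\oplus AY$ and $\mathfrak{R}_{X,Y,A}:(X\oplus Y)A\to XA\oplus YA$ such that for all objects: (Ann-1) $(\mathfrak{L}_{A,X,Y}\oplus \mathrm{id})\mathfrak{L}_{A,X\oplus Y,Z}(\mathrm{id}_A\otimes a^+_{X,Y,Z})=a^+_{AX,AY,AZ}(\mathrm{id}\oplus\mathfrak{L}_{A,Y,Z})\mathfrak{L}_{A,X,Y\oplus Z}$ and $c^+_{AX,AY}\mathfrak{L}_{A,X,Y}=\mathfrak{L}_{A,Y,X}(\mathrm{id}_A\otimes c^+_{X,Y})$, and likewise $(\mathfrak{R}_{X,Y,A}\oplus \mathrm{id})\mathfrak{R}_{X\oplus Y,Z,A}(a^+_{X,Y,Z}\otimes \mathrm{id}_A)=a^+_{XA,YA,ZA}(\mathrm{id}\oplus\mathfrak{R}_{Y,Z,A})\mathfrak{R}_{X,Y\oplus Z,A}$ and $c^+_{XA,YA}\mathfrak{R}_{X,Y,A}=\mathfrak{R}_{Y,X,A}(c^+_{X,Y}\otimes \mathrm{id}_A)$; (Ann-2) (1) $\mathfrak{L}_{AB,X,Y}\circ a_{A,B,X\oplus Y}=(a_{A,B,X}\oplus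 a_{A,B,Y})\circ\mathfrak{L}_{A,BX,BY}\circ(\mathrm{id}_A\otimes\mathfrak{L}_{B,X,Y})$; (2) $(a_{X,B,A}\oplus a_{Y,B,A})\circ\mathfrak{R}_{X,Y,BA}=\mathfrak{R}_{XB,YB,A}\circ(\mathfrak{R}_{X,Y,B}\otimes \mathrm{id}_A)\circ a_{X\oplus Y,B,A}$; (3) $\mathfrak{R}_{AX,AY,B}\circ(\mathfrak{L}_{A,X,Y}\otimes \mathrm{id}_B)\circ a_{A,X\oplus Y,B}=(a_{A,X,B}\oplus a_{A,Y,B})\circ\mathfrak{L}_{A,XB,YB}\circ(\mathrm{id}_A\otimes\mathfrak{R}_{X,Y,B})$; (4) $v_{AX,BX,AY,BY}\circ(\mathfrak{R}_{A,B,X}\oplus\mathfrak{R}_{A,B,Y})\circ\mathfrak{L}_{A\oplus B,X,Y}=(\mathfrak{L}_{A,X,Y}\oplus\mathfrak{L}_{B,X,Y})\circ\mathfrak{R}_{A,B,X\oplus Y}$; (Ann-3) (5.1) $(l_X\oplus l_Y)\circ\mathfrak{L}_{1,X,Y}=l_{X\oplus Y}$, and (5.2) $(r_X\oplus r_Y)\circ\mathfrak{R}_{X,Y,1}=r_{X\oplus Y}$; (6) $\mathfrak{R}_{X,Y,A}\circ c_{A,X\oplus Y}=(c_{A,X}\oplus c_{A,Y})\circ\mathfrak{L}_{A,X,Y}$. *)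

(* Defs.v *)
From Corelib Require Import ssreflect.

Set Implicit Arguments.
Unset Strict Implicit.
Unset Printing Implicit Defensive.

Declare Scope cat_scope.
Delimit Scope cat_scope with cat.
Local Open Scope cat_scope.

Reserved Notation "g ∘ f" (at level 55, right associativity).
Reserved Notation "X ⊕ Y" (at level 50, left associativity).
Reserved Notation "f ⊕₁ g" (at level 50, left associativity).
Reserved Notation "X ⊗ Y" (at level 40, left associativity).
Reserved Notation "f ⊗₁ g" (at level 40, left associativity).

Record category := Category {
  obj :> Type;
  hom : obj -> obj -> Type;
  idm : forall X, hom X X;
  comp : forall X Y Z, hom Y Z -> hom X Y -> hom X Z;
  comp_idl : forall X Y (f : hom X Y), comp (idm Y) f = f;
  comp_idr : forall X Y (f : hom X Y), comp f (idm X) = f;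
  comp_assoc : forall X Y Z T (h : hom Z T) (g : hom Y Z) (f : hom X Y),
    comp h (comp g f) = comp (comp h g) f }.

Arguments hom {c} X Y.
Arguments idm {c} X.
Arguments comp {c X Y Z} g f : rename.

Notation "g ∘ f" := (comp g f) : cat_scope.

Record iso (C : category) (X Y : C) := Iso {
  fwd :> hom X Y;
  bwd : hom Y X;
  bwdK : bwd ∘ fwd = idm X;
  fwdK : fwd ∘ bwd = idm Y }.

Definition is_iso (C : category) (X Y : C) (f : hom X Y) : Prop :=
  exists g : hom Y X, g ∘ f = idm X /\ f ∘ g = idm Y.

Record functor (C D : category) := Functor {
  fobj :> C -> D;
  fmap : forall X Y, hom X Y -> hom (fobj X) (fobj Y);
  fmap_id : forall X, fmap (idm X) = idm (fobj X);
  fmap_comp : forall X Y Z (g : hom Y Z) (f : hom X Y),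
    fmap (g ∘ f) = fmap g ∘ fmap f }.

Arguments fmap {C D} F {X Y} f : rename.

(* Functors C × C -> C, with pairs of objects and of arrows curried. *)
Record bifunctor (C : category) := Bifunctor {
  bobj :> C -> C -> C;
  bmap : forall X X' Y Y', hom X X' -> hom Y Y' -> hom (bobj X Y) (bobj X' Y');
  bmap_id : forall X Y, bmap (idm X) (idm Y) = idm (bobj X Y);
  bmap_comp : forall X X' X'' Y Y' Y'' (f' : hom X' X'') (f : hom X X')
      (g' : hom Y' Y'') (g : hom Y Y'),
    bmap (f' ∘ f) (g' ∘ g) = bmap f' g' ∘ bmap f g }.

Arguments bmap {C} T {X X' Y Y'} f g : rename.

Section PartialApplication.

Context (C : category) (T : bifunctor C) (A : C).

Lemma bmap_id_comp X Y Z (g : hom Y Z) (f : hom X Y) :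
  bmap T (idm A) (g ∘ f) = bmap T (idm A) g ∘ bmap T (idm A) f.
Proof. by rewrite -bmap_comp comp_idl. Qed.

Lemma bmap_comp_id X Y Z (g : hom Y Z) (f : hom X Y) :
  bmap T (g ∘ f) (idm A) = bmap T g (idm A) ∘ bmap T f (idm A).
Proof. by rewrite -bmap_comp comp_idl. Qed.

(* T(A, -) *)
Definition left_functor : functor C C :=
  @Functor C C (fun X => T A X) (fun X Y f => bmap T (idm A) f)
    (fun X => bmap_id T A X) bmap_id_comp.

(* T(-, A) *)
Definition right_functor : functor C C :=
  @Functor C C (fun X => T X A) (fun X Y f => bmap T f (idm A))
    (fun X => bmap_id T X A) bmap_comp_id.

End PartialApplication.

Section Monoidal.

Context (C : category) (T : bifunctor C).
Local Notation "X ⊗ Y" := (T X Y) : cat_scope.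
Local Notation "f ⊗₁ g" := (bmap T f g) : cat_scope.

(* Mac Lane's axioms: pentagon and triangle; then symmetry, compatibility of
   the braiding with the units, and hexagon. *)
Record symmetric_monoidal := SymmetricMonoidal {
  unit : C;
  assoc : forall X Y Z, iso (X ⊗ (Y ⊗ Z)) ((X ⊗ Y) ⊗ Z);
  braid : forall X Y, iso (X ⊗ Y) (Y ⊗ X);
  lunit : forall X, iso (unit ⊗ X) X;
  runit : forall X, iso (X ⊗ unit) X;
  assoc_nat : forall X X' Y Y' Z Z' (f : hom X X') (g : hom Y Y') (h : hom Z Z'),
    assoc X' Y' Z' ∘ (f ⊗₁ (g ⊗₁ h)) = ((f ⊗₁ g) ⊗₁ h) ∘ assoc X Y Z;
  braid_nat : forall X X' Y Y' (f : hom X X') (g : hom Y Y'),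
    braid X' Y' ∘ (f ⊗₁ g) = (g ⊗₁ f) ∘ braid X Y;
  lunit_nat : forall X X' (f : hom X X'),
    lunit X' ∘ (idm unit ⊗₁ f) = f ∘ lunit X;
  runit_nat : forall X X' (f : hom X X'),
    runit X' ∘ (f ⊗₁ idm unit) = f ∘ runit X;
  pentagon : forall X Y Z W,
    assoc (X ⊗ Y) Z W ∘ assoc X Y (Z ⊗ W) =
    (assoc X Y Z ⊗₁ idm W) ∘ assoc X (Y ⊗ Z) W ∘ (idm X ⊗₁ assoc Y Z W);
  triangle : forall X Y,
    (runit X ⊗₁ idm Y) ∘ assoc X unit Y = idm X ⊗₁ lunit Y;
  braidK : forall X Y, braid Y X ∘ braid X Y = idm (X ⊗ Y);
  braid_unit : forall X, lunit X ∘ braid X unit = runit X;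
  hexagon : forall X Y Z,
    assoc Z X Y ∘ braid (X ⊗ Y) Z ∘ assoc X Y Z =
    (braid X Z ⊗₁ idm Y) ∘ assoc X Z Y ∘ (idm X ⊗₁ braid Y Z) }.

Record symmetric_categorical_group := SymmetricCategoricalGroup {
  scg_monoidal :> symmetric_monoidal;
  scg_groupoid : forall (X Y : C) (f : hom X Y), is_iso f;
  scg_inverse : forall X : C,
    exists X' : C, inhabited (iso (X ⊗ X') (unit scg_monoidal)) }.

(* The canonical isomorphism exchanging the two middle factors. *)
Definition interchange (S : symmetric_monoidal) (U V Z W : C) :
    hom ((U ⊗ V) ⊗ (Z ⊗ W)) ((U ⊗ Z) ⊗ (V ⊗ W)) :=
  assoc S U Z (V ⊗ W) ∘
  (idm U ⊗₁ bwd (assoc S Z V W)) ∘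
  (idm U ⊗₁ (braid S V Z ⊗₁ idm W)) ∘
  (idm U ⊗₁ assoc S V Z W) ∘
  bwd (assoc S U V (Z ⊗ W)).

End Monoidal.

Arguments unit {C T} s.
Arguments assoc {C T} s X Y Z.
Arguments braid {C T} s X Y.
Arguments lunit {C T} s X.
Arguments runit {C T} s X.

Section OplusFunctor.

Context (C : category) (oplus : bifunctor C) (S : symmetric_monoidal oplus).
Context (F : functor C C).
Local Notation "X ⊕ Y" := (oplus X Y) : cat_scope.
Local Notation "f ⊕₁ g" := (bmap oplus f g) : cat_scope.

Context (phi : forall X Y, iso (F (X ⊕ Y)) (F X ⊕ F Y)).

(* No condition on units: (F, phi) is an ⊕-functor as soon as phi is natural. *)
Definition is_oplus_functor : Prop :=
  forall X X' Y Y' (f : hom X X') (g : hom Y Y'),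
    phi X' Y' ∘ fmap F (f ⊕₁ g) = (fmap F f ⊕₁ fmap F g) ∘ phi X Y.

Definition compatible_assoc : Prop := forall X Y Z,
  (phi X Y ⊕₁ idm (F Z)) ∘ phi (X ⊕ Y) Z ∘ fmap F (assoc S X Y Z) =
  assoc S (F X) (F Y) (F Z) ∘ (idm (F X) ⊕₁ phi Y Z) ∘ phi X (Y ⊕ Z).

Definition compatible_braid : Prop := forall X Y,
  braid S (F X) (F Y) ∘ phi X Y = phi Y X ∘ fmap F (braid S X Y).

End OplusFunctor.

Section AnnCategory.

Context (C : category) (oplus otimes : bifunctor C).
Local Notation "X ⊕ Y" := (oplus X Y) : cat_scope.
Local Notation "f ⊕₁ g" := (bmap oplus f g) : cat_scope.
Local Notation "X ⊗ Y" := (otimes X Y) : cat_scope.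
Local Notation "f ⊗₁ g" := (bmap otimes f g) : cat_scope.

Record left_distributivity := LeftDistributivity {
  ldistr :> forall A X Y, iso (A ⊗ (X ⊕ Y)) ((A ⊗ X) ⊕ (A ⊗ Y));
  ldistr_nat : forall A A' X X' Y Y'
      (f : hom A A') (g : hom X X') (h : hom Y Y'),
    ldistr A' X' Y' ∘ (f ⊗₁ (g ⊕₁ h)) =
    ((f ⊗₁ g) ⊕₁ (f ⊗₁ h)) ∘ ldistr A X Y }.

Record right_distributivity := RightDistributivity {
  rdistr :> forall X Y A, iso ((X ⊕ Y) ⊗ A) ((X ⊗ A) ⊕ (Y ⊗ A));
  rdistr_nat : forall X X' Y Y' A A'
      (g : hom X X') (h : hom Y Y') (f : hom A A'),
    rdistr X' Y' A' ∘ ((g ⊕₁ h) ⊗₁ f) =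
    ((g ⊗₁ f) ⊕₁ (h ⊗₁ f)) ∘ rdistr X Y A }.

Section Distributivity.

Context (S : symmetric_monoidal oplus) (M : symmetric_monoidal otimes).
Context (L : left_distributivity) (R : right_distributivity).
Local Notation v := (interchange S).
Local Notation a := (assoc M).
Local Notation c := (braid M).
Local Notation l := (lunit M).
Local Notation r := (runit M).
Local Notation "1" := (unit M) : cat_scope.

Definition ldistr_assoc : Prop := forall A B X Y,
  L (A ⊗ B) X Y ∘ a A B (X ⊕ Y) =
  (a A B X ⊕₁ a A B Y) ∘ L A (B ⊗ X) (B ⊗ Y) ∘ (idm A ⊗₁ L B X Y).

Definition rdistr_assoc : Prop := forall X Y A B,
  (a X B A ⊕₁ a Y B A) ∘ R X Y (B ⊗ A) =
  R (X ⊗ B) (Y ⊗ B) A ∘ (R X Y B ⊗₁ idm A) ∘ a (X ⊕ Y) B A.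

Definition lrdistr_assoc : Prop := forall A B X Y,
  R (A ⊗ X) (A ⊗ Y) B ∘ (L A X Y ⊗₁ idm B) ∘ a A (X ⊕ Y) B =
  (a A X B ⊕₁ a A Y B) ∘ L A (X ⊗ B) (Y ⊗ B) ∘ (idm A ⊗₁ R X Y B).

Definition lrdistr_interchange : Prop := forall A B X Y,
  v (A ⊗ X) (B ⊗ X) (A ⊗ Y) (B ⊗ Y) ∘ (R A B X ⊕₁ R A B Y) ∘ L (A ⊕ B) X Y =
  (L A X Y ⊕₁ L B X Y) ∘ R A B (X ⊕ Y).

Definition ldistr_unit : Prop := forall X Y,
  (l X ⊕₁ l Y) ∘ L 1 X Y = l (X ⊕ Y).

Definition rdistr_unit : Prop := forall X Y,
  (r X ⊕₁ r Y) ∘ R X Y 1 = r (X ⊕ Y).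

Definition lrdistr_braid : Prop := forall A X Y,
  R X Y A ∘ c A (X ⊕ Y) = (c A X ⊕₁ c A Y) ∘ L A X Y.

Definition ldistr_interchange : Prop := forall A B X Y,
  (L X A B ⊕₁ L Y A B) ∘ (c (A ⊕ B) X ⊕₁ c (A ⊕ B) Y) ∘
    L (A ⊕ B) X Y ∘ c (X ⊕ Y) (A ⊕ B) =
  ((c A X ⊕₁ c B X) ⊕₁ (c A Y ⊕₁ c B Y)) ∘
    v (A ⊗ X) (A ⊗ Y) (B ⊗ X) (B ⊗ Y) ∘
    (L A X Y ⊕₁ L B X Y) ∘ (c (X ⊕ Y) A ⊕₁ c (X ⊕ Y) B) ∘ L (X ⊕ Y) A B.

End Distributivity.

Record symmetric_ann_category := SymmetricAnnCategory {
  ann_add : symmetric_categorical_group oplus;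
  ann_mul : symmetric_monoidal otimes;
  ann_braid00 : fwd (braid ann_mul (unit ann_add) (unit ann_add)) =
    idm (unit ann_add ⊗ unit ann_add);
  ann_L : left_distributivity;
  ann_R : right_distributivity;
  ann_L_add_assoc : forall A,
    @compatible_assoc C oplus ann_add (left_functor otimes A) (ann_L A);
  ann_L_add_braid : forall A,
    @compatible_braid C oplus ann_add (left_functor otimes A) (ann_L A);
  ann_R_add_assoc : forall A,
    @compatible_assoc C oplus ann_add (right_functor otimes A)
      (fun X Y => ann_R X Y A);
  ann_R_add_braid : forall A,
    @compatible_braid C oplus ann_add (right_functor otimes A)
      (fun X Y => ann_R X Y A);
  ann_ldistr_assoc : ldistr_assoc ann_mul ann_L;
  ann_rdistr_assoc : rdistr_assoc ann_mul ann_R;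
  ann_lrdistr_assoc : lrdistr_assoc ann_mul ann_L ann_R;
  ann_lrdistr_interchange : lrdistr_interchange ann_add ann_L ann_R;
  ann_ldistr_unit : ldistr_unit ann_mul ann_L;
  ann_rdistr_unit : rdistr_unit ann_mul ann_R;
  ann_lrdistr_braid : lrdistr_braid ann_mul ann_L ann_R }.

End AnnCategory.

(* Main.v *)
(** Condition (6) forces [R X Y A = (c A X ⊕₁ c A Y) ∘ L A X Y ∘ c (X ⊕ Y) A],
    and it may be used to define [R] from [L]. Under (6) the conditions on [R]
    follow from those on [L] by naturality and the hexagon, while (4) is (8)
    because the interchange [v] is an involution.

    For [c 0 0 = id]: the object [0 ⊗ 0] is isomorphic to [0], and the
    endomorphisms of [0] form a commutative group in which [⊕₁] is composition.
    There the two maps [0 ⊗ 0 -> 0 ⊗ 0 ⊕ 0 ⊗ 0] given by [L] and [R] become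
    elements [x] and [y], and [c 0 0] becomes an element [z]. An
    Eckmann-Hilton argument on (4) yields [y y x = x x y], so [x = y], and (6)
    yields [z z x = y z], so [z = 1]. *)

From Corelib Require Import ssreflect ssrfun.
Require Import Defs.

Set Implicit Arguments.
Unset Strict Implicit.
Unset Printing Implicit Defensive.

Local Open Scope cat_scope.

(** * Calculus of composites and isomorphisms in a category *)

Section Isomorphisms.

Context (C : category).

(** Composites are kept nested to the right, where [g ∘ f] is not a subterm of [g ∘ f ∘ k]; this
    makes an equation usable as a rewrite rule there. *)
Lemma comp_under (X Y Z W : C) (g : hom Y Z) (f : hom X Y) (h : hom X Z) :
  g ∘ f = h -> forall k : hom W X, g ∘ f ∘ k = h ∘ k.
Proof. by move=> <- k; rewrite comp_assoc. Qed.

Lemma comp3_under (X Y Z T W : C) (h : hom Z T) (g : hom Y Z) (f : hom X Y)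
    (e : hom X T) :
  h ∘ g ∘ f = e -> forall k : hom W X, h ∘ g ∘ f ∘ k = e ∘ k.
Proof. by move=> <- k; rewrite -!comp_assoc. Qed.

Lemma bwdKA (X Y W : C) (i : iso X Y) (k : hom W X) : bwd i ∘ i ∘ k = k.
Proof. by rewrite comp_assoc bwdK comp_idl. Qed.

Lemma fwdKA (X Y W : C) (i : iso X Y) (k : hom W Y) : i ∘ bwd i ∘ k = k.
Proof. by rewrite comp_assoc fwdK comp_idl. Qed.

Lemma iso_monic (X Y W : C) (i : iso X Y) (f g : hom W X) :
  i ∘ f = i ∘ g -> f = g.
Proof. by move=> E; rewrite -(bwdKA i f) E bwdKA. Qed.

Lemma iso_epic (X Y W : C) (i : iso X Y) (f g : hom Y W) :
  f ∘ i = g ∘ i -> f = g.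
Proof.
by move=> E; rewrite -(comp_idr f) -(comp_idr g) -(fwdK i) !comp_assoc E.
Qed.

Definition iso_sym (X Y : C) (i : iso X Y) : iso Y X := Iso (fwdK i) (bwdK i).

Definition iso_id (X : C) : iso X X :=
  Iso (comp_idl (idm X)) (comp_idl (idm X)).

Lemma iso_comp_bwdK (X Y Z : C) (j : iso Y Z) (i : iso X Y) :
  (bwd i ∘ bwd j) ∘ (j ∘ i) = idm X.
Proof. by rewrite -comp_assoc bwdKA bwdK. Qed.

Lemma iso_comp_fwdK (X Y Z : C) (j : iso Y Z) (i : iso X Y) :
  (j ∘ i) ∘ (bwd i ∘ bwd j) = idm Z.
Proof. by rewrite -comp_assoc fwdKA fwdK. Qed.

Definition iso_comp (X Y Z : C) (j : iso Y Z) (i : iso X Y) : iso X Z :=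
  Iso (iso_comp_bwdK j i) (iso_comp_fwdK j i).

Lemma iso_bwd_square (X Y X' Y' : C) (i : iso X Y) (j : iso X' Y')
    (f : hom X X') (g : hom Y Y') :
  j ∘ f = g ∘ i -> f ∘ bwd i = bwd j ∘ g.
Proof.
move=> E; apply: (iso_monic (i := j)); apply: (iso_epic (i := i)).
by rewrite -!comp_assoc bwdK comp_idr fwdKA.
Qed.

Context (T : bifunctor C).
Local Notation "f ⊗₁ g" := (bmap T f g) : cat_scope.

Lemma bmap_compA (X X' X'' Y Y' Y'' W : C) (f' : hom X' X'') (f : hom X X')
    (g' : hom Y' Y'') (g : hom Y Y') (k : hom W (T X Y)) :
  (f' ⊗₁ g') ∘ (f ⊗₁ g) ∘ k = ((f' ∘ f) ⊗₁ (g' ∘ g)) ∘ k.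
Proof. by rewrite bmap_comp comp_assoc. Qed.

Lemma bmap_iso_bwdK (X X' Y Y' : C) (i : iso X X') (j : iso Y Y') :
  (bwd i ⊗₁ bwd j) ∘ (i ⊗₁ j) = idm (T X Y).
Proof. by rewrite -bmap_comp !bwdK bmap_id. Qed.

Lemma bmap_iso_fwdK (X X' Y Y' : C) (i : iso X X') (j : iso Y Y') :
  (i ⊗₁ j) ∘ (bwd i ⊗₁ bwd j) = idm (T X' Y').
Proof. by rewrite -bmap_comp !fwdK bmap_id. Qed.

Definition bmap_iso (X X' Y Y' : C) (i : iso X X') (j : iso Y Y') :
    iso (T X Y) (T X' Y') :=
  Iso (bmap_iso_bwdK i j) (bmap_iso_fwdK i j).

End Isomorphisms.

(** * Coherence in a symmetric monoidal category *)

Section SymmetricMonoidal.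

Context (C : category) (T : bifunctor C) (M : symmetric_monoidal T).
Local Notation "X ⊗ Y" := (T X Y) : cat_scope.
Local Notation "f ⊗₁ g" := (bmap T f g) : cat_scope.
Local Notation a := (assoc M).
Local Notation c := (braid M).
Local Notation l := (lunit M).
Local Notation r := (runit M).
Local Notation "1" := (unit M) : cat_scope.

Lemma braidKA (X Y W : C) (k : hom W (X ⊗ Y)) : c Y X ∘ c X Y ∘ k = k.
Proof. by rewrite comp_assoc braidK comp_idl. Qed.

Lemma braid_natA (X X' Y Y' W : C) (f : hom X X') (g : hom Y Y')
    (k : hom W (X ⊗ Y)) :
  c X' Y' ∘ (f ⊗₁ g) ∘ k = (g ⊗₁ f) ∘ c X Y ∘ k.
Proof. by rewrite comp_assoc braid_nat -comp_assoc. Qed.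

Lemma hexagon_bwd (A X B : C) :
  c B (A ⊗ X) ∘ bwd (a B A X) ∘ (c A B ⊗₁ idm X) =
  a A X B ∘ (idm A ⊗₁ c B X) ∘ bwd (a A B X).
Proof.
apply: (iso_epic (i := a A B X)).
rewrite -!comp_assoc bwdK comp_idr.
apply: (iso_epic (i := bmap_iso T (iso_id A) (c X B))).
rewrite /= -!comp_assoc -hexagon bwdKA braidKA.
by rewrite -bmap_comp braidK comp_idl bmap_id comp_idr.
Qed.

(** Both sides reverse the order of [W], [B], [A]; two uses of the hexagon and naturality of the
    braiding identify them. *)
Lemma hexagon_swap (W B A : C) :
  a A B W ∘ (idm A ⊗₁ c W B) ∘ c (W ⊗ B) A ∘ a W B A =
  (c B A ⊗₁ idm W) ∘ c W (B ⊗ A).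
Proof.
rewrite -(bwdKA (a A W B) (c (W ⊗ B) A ∘ a W B A)) hexagon.
rewrite (comp3_under (esym (hexagon_bwd A B W))) -!comp_assoc.
rewrite bmap_compA braidK comp_idl bmap_id comp_idl bwdKA.
exact: braid_nat.
Qed.

(** Precomposed with the left side of [hexagon_swap], which is invertible, both sides become
    [a X B A]. *)
Lemma hexagon_swap_bwd (X B A : C) :
  c A (X ⊗ B) ∘ (idm A ⊗₁ c B X) ∘ bwd (a A B X) =
  a X B A ∘ c (B ⊗ A) X ∘ (c A B ⊗₁ idm X).
Proof.
pose i := iso_comp (a A B X)
  (iso_comp (bmap_iso T (iso_id A) (c X B)) (iso_comp (c (X ⊗ B) A) (a X B A))).
apply: (iso_epic (i := i)); rewrite /i /= -!comp_assoc.
rewrite bwdKA bmap_compA braidK comp_idl bmap_id comp_idl braidKA hexagon_swap.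
by rewrite bmap_compA braidK comp_idl bmap_id comp_idl braidK comp_idr.
Qed.

Lemma runit_braid (X : C) : r X ∘ c 1 X = l X.
Proof. by rewrite -braid_unit -comp_assoc braidK comp_idr. Qed.

Lemma lunit_faithful (X Y : C) (f g : hom X Y) :
  idm 1 ⊗₁ f = idm 1 ⊗₁ g -> f = g.
Proof.
by move=> E; apply: (iso_epic (i := l X)); rewrite -!lunit_nat E.
Qed.

Lemma runit_faithful (X Y : C) (f g : hom X Y) :
  f ⊗₁ idm 1 = g ⊗₁ idm 1 -> f = g.
Proof.
by move=> E; apply: (iso_epic (i := r X)); rewrite -!runit_nat E.
Qed.

(** Tensoring with [1] is faithful, and after it the claim follows from the pentagon at [1], [1],
    [X], [Y] and the triangle. *)
Lemma lunit_tensor (X Y : C) : (l X ⊗₁ idm Y) ∘ a 1 X Y = l (X ⊗ Y).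
Proof.
apply: lunit_faithful; rewrite bmap_id_comp.
apply: (iso_monic (i := a 1 X Y)).
rewrite comp_assoc assoc_nat -!triangle comp_assoc -(bmap_id T X Y) assoc_nat.
rewrite -!comp_assoc pentagon !comp_assoc -!bmap_comp.
by rewrite comp_idl triangle.
Qed.

(* Kelly's redundant axiom for monoidal categories. *)
Lemma lunit_runit_unit : fwd (l 1) = r 1.
Proof.
apply: runit_faithful; apply: (iso_epic (i := a 1 1 1)).
rewrite triangle lunit_tensor; apply: (iso_monic (i := l 1)).
by rewrite lunit_nat.
Qed.

Lemma braid_unit_unit : fwd (c 1 1) = idm (1 ⊗ 1).
Proof.
apply: (iso_monic (i := l 1)).
by rewrite braid_unit comp_idr lunit_runit_unit.
Qed.

Lemma interchangeK (U V Z W : C) :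
  interchange M U Z V W ∘ interchange M U V Z W = idm _.
Proof.
rewrite /interchange -!comp_assoc bwdKA !bmap_compA !comp_idl -!comp_assoc.
rewrite fwdKA bmap_compA braidK comp_idl bmap_id comp_idl bwdK bmap_id comp_idl.
exact: fwdK.
Qed.

Lemma interchange_unit : interchange M 1 1 1 1 = idm _.
Proof.
rewrite /interchange braid_unit_unit bmap_id bmap_id comp_idl.
by rewrite bmap_compA bwdK comp_idl bmap_id comp_idl fwdK.
Qed.

Lemma interchange_nat (U U' V V' Z Z' W W' : C)
    (f : hom U U') (g : hom V V') (h : hom Z Z') (k : hom W W') :
  interchange M U' V' Z' W' ∘ ((f ⊗₁ g) ⊗₁ (h ⊗₁ k)) =
  ((f ⊗₁ h) ⊗₁ (g ⊗₁ k)) ∘ interchange M U V Z W.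
Proof.
have E X X' Y Y' S S' (p : hom X X') (q : hom Y Y') (s : hom S S') :=
  iso_bwd_square (assoc_nat M p q s).
(* The three middle factors of the interchange act on the last three objects only, so their
   naturality is settled without [f]. *)
have swap : (bwd (a Z' V' W') ∘ (c V' Z' ⊗₁ idm W') ∘ a V' Z' W') ∘
      (g ⊗₁ (h ⊗₁ k)) =
    (h ⊗₁ (g ⊗₁ k)) ∘ bwd (a Z V W) ∘ (c V Z ⊗₁ idm W) ∘ a V Z W.
  rewrite -!comp_assoc assoc_nat bmap_compA comp_idl braid_nat.
  by rewrite (comp_under (E _ _ _ _ _ _ h g k)) -comp_assoc bmap_compA comp_idr.
rewrite /interchange -!comp_assoc -E !bmap_compA !comp_idl -!comp_assoc.
rewrite -!comp_assoc in swap; rewrite swap.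
rewrite (comp_under (esym (assoc_nat M f h (g ⊗₁ k)))) -comp_assoc bmap_compA.
by rewrite comp_idr.
Qed.

(** Eckmann-Hilton: as [l 1 = r 1], naturality of [r] extracts [x] and then naturality of [l]
    extracts [y]. Extracting in the other order gives commutativity. *)
Lemma endo_unit_tensor (x y : hom 1 1) : l 1 ∘ (x ⊗₁ y) = x ∘ y ∘ l 1.
Proof.
rewrite -{1}(comp_idr x) -{1}(comp_idl y) bmap_comp comp_assoc.
by rewrite {1}lunit_runit_unit runit_nat -lunit_runit_unit -comp_assoc lunit_nat.
Qed.

Lemma endo_unit_comm (x y : hom 1 1) : x ∘ y = y ∘ x.
Proof.
apply: (iso_epic (i := l 1)); rewrite -!comp_assoc -endo_unit_tensor.
rewrite -{1}(comp_idl x) -{1}(comp_idr y) bmap_comp comp_assoc.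
by rewrite lunit_nat -comp_assoc {1}lunit_runit_unit runit_nat lunit_runit_unit.
Qed.

End SymmetricMonoidal.

(** * Left distributivity and the right distributivity it induces *)

Section Distributivity.

Context (C : category) (oplus otimes : bifunctor C).
Local Notation "X ⊕ Y" := (oplus X Y) : cat_scope.
Local Notation "f ⊕₁ g" := (bmap oplus f g) : cat_scope.
Local Notation "X ⊗ Y" := (otimes X Y) : cat_scope.
Local Notation "f ⊗₁ g" := (bmap otimes f g) : cat_scope.

Context (S : symmetric_monoidal oplus) (M : symmetric_monoidal otimes).
Context (L : left_distributivity oplus otimes).
Local Notation v := (interchange S).
Local Notation a := (assoc M).
Local Notation c := (braid M).
Local Notation l := (lunit M).
Local Notation r := (runit M).
Local Notation "1" := (unit M) : cat_scope.

Lemma ldistr_natl (A A' X Y : C) (f : hom A A') :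
  L A' X Y ∘ (f ⊗₁ idm (X ⊕ Y)) =
  ((f ⊗₁ idm X) ⊕₁ (f ⊗₁ idm Y)) ∘ L A X Y.
Proof. by rewrite -(bmap_id oplus) ldistr_nat. Qed.

Lemma ldistr_assoc_bwd : ldistr_assoc M L -> forall A B X Y,
  L A (B ⊗ X) (B ⊗ Y) ∘ (idm A ⊗₁ L B X Y) =
  (bwd (a A B X) ⊕₁ bwd (a A B Y)) ∘ L (A ⊗ B) X Y ∘ a A B (X ⊕ Y).
Proof.
by move=> H A B X Y; rewrite H bmap_compA !bwdK bmap_id comp_idl.
Qed.

Definition rdistr_of_iso (X Y A : C) : iso ((X ⊕ Y) ⊗ A) ((X ⊗ A) ⊕ (Y ⊗ A)) :=
  iso_comp (bmap_iso oplus (c A X) (c A Y)) (iso_comp (L A X Y) (c (X ⊕ Y) A)).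

Lemma rdistr_of_nat (X X' Y Y' A A' : C)
    (g : hom X X') (h : hom Y Y') (f : hom A A') :
  rdistr_of_iso X' Y' A' ∘ ((g ⊕₁ h) ⊗₁ f) =
  ((g ⊗₁ f) ⊕₁ (h ⊗₁ f)) ∘ rdistr_of_iso X Y A.
Proof.
rewrite /= -!comp_assoc braid_nat (comp_under (ldistr_nat L _ _ _)) -comp_assoc.
by rewrite !bmap_compA !braid_nat.
Qed.

Definition rdistr_of : right_distributivity oplus otimes :=
  @RightDistributivity _ _ _ rdistr_of_iso rdistr_of_nat.

Lemma rdistr_of_braid : lrdistr_braid M L rdistr_of.
Proof. by move=> A X Y; rewrite /= -!comp_assoc braidK comp_idr. Qed.

(** * Transport of the laws for [L] to [R] along the braiding *)

Section RightDistributivity.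

Context (R : right_distributivity oplus otimes).
Hypothesis LRc : lrdistr_braid M L R.

Lemma rdistrE (X Y A : C) :
  fwd (R X Y A) = (c A X ⊕₁ c A Y) ∘ L A X Y ∘ c (X ⊕ Y) A.
Proof. by rewrite comp_assoc -LRc -comp_assoc braidK comp_idr. Qed.

Lemma braid_rdistr (X Y A : C) :
  (c X A ⊕₁ c Y A) ∘ R X Y A = L A X Y ∘ c (X ⊕ Y) A.
Proof.
by rewrite rdistrE bmap_compA !braidK bmap_id comp_idl.
Qed.

Lemma lrdistr_interchangeE :
  lrdistr_interchange S L R <-> ldistr_interchange S M L.
Proof.
(* Abstracting [v] keeps rewriting with [comp_assoc] from unfolding it. *)
rewrite /lrdistr_interchange /ldistr_interchange.
move: (interchange S) (interchangeK S) => w wK.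
split=> H A B X Y; have {}H := H A B X Y.
  rewrite bmap_compA -(braid_rdistr A B X) -(braid_rdistr A B Y) bmap_comp.
  rewrite -!comp_assoc.
  rewrite -LRc (comp_under (esym H)) -!comp_assoc.
  by rewrite (comp_under (wK _ _ _ _)) comp_idl.
(* Once [R] is introduced, both sides begin with [P] and end with the same braiding; cancelling
   these leaves the goal with [w] on the other side. *)
pose P := bmap_iso oplus (bmap_iso oplus (c A X) (c B X))
  (bmap_iso oplus (c A Y) (c B Y)).
rewrite bmap_compA -(braid_rdistr A B X) -(braid_rdistr A B Y) bmap_comp in H.
rewrite -!comp_assoc -LRc in H; move/(iso_monic (i := P)): H; rewrite !comp_assoc.
move/(iso_epic (i := c (X ⊕ Y) (A ⊕ B))); rewrite -!comp_assoc => ->.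
by rewrite (comp_under (wK _ _ _ _)) comp_idl.
Qed.

(** Precomposition with a braiding turns each [R] into an [L] as the braiding slides through;
    naturality of the associator then closes the diagram. *)
Lemma rdistr_compatible_assoc (A : C) :
  @compatible_assoc C oplus S (left_functor otimes A) (L A) ->
  @compatible_assoc C oplus S (right_functor otimes A) (fun X Y => R X Y A).
Proof.
move=> H X Y Z; have {}H := H X Y Z; rewrite /= in H *.
apply: (iso_epic (i := c A (X ⊕ (Y ⊕ Z)))).
rewrite -!comp_assoc -braid_nat LRc (comp_under (LRc _ _ _)) -comp_assoc.
rewrite !bmap_compA !comp_idl !LRc.
(* The inserted identities let [⊕₁] split off the braidings, exposing the diagram for [L]. *)
rewrite -{1}(comp_idr (c A Z)) -{2}(comp_idr (c A X)) !bmap_comp -!comp_assoc H.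
by rewrite !comp_assoc assoc_nat.
Qed.

Lemma rdistr_compatible_braid (A : C) :
  @compatible_braid C oplus S (left_functor otimes A) (L A) ->
  @compatible_braid C oplus S (right_functor otimes A) (fun X Y => R X Y A).
Proof.
move=> H X Y; have {}H := H X Y; rewrite /= in H *.
apply: (iso_epic (i := c A (X ⊕ Y))).
rewrite -!comp_assoc -braid_nat LRc (comp_under (LRc _ _ _)) -comp_assoc -H.
by rewrite !comp_assoc braid_nat.
Qed.

Lemma rdistr_unit_of : ldistr_unit M L -> rdistr_unit M R.
Proof.
move=> H X Y; rewrite rdistrE bmap_compA !runit_braid comp_assoc H.
exact: braid_unit.
Qed.

(** With [R] expanded, each side contains two nested distributors; the law for [L] merges them, and
    the hexagon brings both sides to [L (A ⊗ B) X Y]. *)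
Lemma lrdistr_assoc_of : ldistr_assoc M L -> lrdistr_assoc M L R.
Proof.
move=> /ldistr_assoc_bwd H A B X Y.
rewrite !rdistrE !bmap_id_comp -!comp_assoc.
rewrite (comp_under (braid_nat _ _ _)) -comp_assoc.
rewrite (comp_under (H _ _ _ _)) -!comp_assoc hexagon.
rewrite (comp_under (ldistr_natl _ _ _)) -comp_assoc 2!bmap_compA.
rewrite -!comp_assoc !hexagon_bwd.
rewrite (comp_under (ldistr_nat L _ _ _)) -comp_assoc bmap_compA.
by rewrite (comp_under (H _ _ _ _)) -!comp_assoc bmap_compA -!comp_assoc.
Qed.

(** The right side merges into [L (A ⊗ B) X Y]; naturality in the first argument moves the braiding
    of [B] and [A] across it, where it cancels. *)
Lemma rdistr_assoc_of : ldistr_assoc M L -> rdistr_assoc M R.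
Proof.
move=> /ldistr_assoc_bwd H X Y A B.
rewrite !rdistrE !bmap_comp_id -!comp_assoc !braid_natA.
rewrite (comp_under (ldistr_nat L _ _ _)) -comp_assoc bmap_compA.
rewrite (comp_under (H _ _ _ _)) -!comp_assoc bmap_compA hexagon_swap.
rewrite !bmap_compA -!comp_assoc !hexagon_swap_bwd.
rewrite (comp_under (ldistr_natl _ _ _)) -comp_assoc !bmap_compA.
by rewrite -!comp_assoc -!bmap_comp !braidK !comp_idl !bmap_id !comp_idr.
Qed.

End RightDistributivity.
End Distributivity.

(** * Maps from an object to its double in a categorical group *)

Section CategoricalGroup.

Context (C : category) (T : bifunctor C) (S : symmetric_categorical_group T).
Local Notation "X ⊕ Y" := (T X Y) : cat_scope.
Local Notation "f ⊕₁ g" := (bmap T f g) : cat_scope.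
Local Notation "0" := (unit S) : cat_scope.
Local Notation g := (lunit S 0).

Lemma scg_monic (X Y Z : C) (h : hom Y Z) (f f' : hom X Y) :
  h ∘ f = h ∘ f' -> f = f'.
Proof.
have [k [kK Kk]] := scg_groupoid S h.
exact: (iso_monic (i := Iso kK Kk)).
Qed.

Lemma scg_epic (X Y Z : C) (h : hom X Y) (f f' : hom Y Z) :
  f ∘ h = f' ∘ h -> f = f'.
Proof.
have [k [kK Kk]] := scg_groupoid S h.
exact: (iso_epic (i := Iso kK Kk)).
Qed.

(** Cancellation with an inverse [E']: [E ≅ E ⊕ 0 ≅ E ⊕ (E ⊕ E') ≅ (E ⊕ E) ⊕ E' ≅ E ⊕ E' ≅ 0]. *)
Lemma scg_iso_unit (E : C) : iso E (E ⊕ E) -> inhabited (iso E 0).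
Proof.
move=> m; have [E' [i]] := scg_inverse S E; constructor.
pose j := iso_comp (bmap_iso T (iso_id E) (iso_sym i)) (iso_sym (runit S E)).
pose k := iso_comp (bmap_iso T (iso_sym m) (iso_id E')) (assoc S E E E').
exact: iso_comp i (iso_comp k j).
Qed.

Section Doubling.

Context (E : C) (e : iso E 0).

Lemma transport_exists (m : hom E (E ⊕ E)) :
  exists x : hom 0 0, x ∘ e = g ∘ (e ⊕₁ e) ∘ m.
Proof.
by exists (g ∘ (e ⊕₁ e) ∘ m ∘ bwd e); rewrite -!comp_assoc bwdK comp_idr.
Qed.

Lemma transport_double (m n : hom E (E ⊕ E)) (x y : hom 0 0) :
  x ∘ e = g ∘ (e ⊕₁ e) ∘ m -> y ∘ e = g ∘ (e ⊕₁ e) ∘ n ->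
  g ∘ (g ⊕₁ g) ∘ ((e ⊕₁ e) ⊕₁ (e ⊕₁ e)) ∘ (n ⊕₁ n) ∘ m = y ∘ y ∘ x ∘ e.
Proof.
move=> Hx Hy; rewrite !bmap_compA -!comp_assoc -Hy bmap_comp -!comp_assoc.
by rewrite (comp_under (endo_unit_tensor _ _)) -!comp_assoc -Hx.
Qed.

Lemma doubling_unique (m n : hom E (E ⊕ E)) :
  interchange S E E E E ∘ (n ⊕₁ n) ∘ m = (m ⊕₁ m) ∘ n -> m = n.
Proof.
move=> H; have [x Hx] := transport_exists m; have [y Hy] := transport_exists n.
(* Naturality carries the interchange to four copies of [0], where it is the identity. *)
have E4 : g ∘ (g ⊕₁ g) ∘ ((e ⊕₁ e) ⊕₁ (e ⊕₁ e)) ∘ interchange S E E E E =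
    g ∘ (g ⊕₁ g) ∘ ((e ⊕₁ e) ⊕₁ (e ⊕₁ e)).
  by rewrite -interchange_nat interchange_unit comp_idl.
have D : y ∘ y ∘ x ∘ e = x ∘ x ∘ y ∘ e.
  rewrite -(transport_double Hx Hy) -(transport_double Hy Hx) -H.
  by move: (interchange S) E4 => w E4; rewrite !comp_assoc in E4 *; rewrite E4.
have yx : y = x.
  (* Commutativity brings [x] to the front on the left; then [x] and [y ∘ e] cancel. *)
  move: D; do 2!rewrite (comp_under (endo_unit_comm y x)) -comp_assoc.
  by move=> /scg_monic/scg_epic.
by apply: (scg_monic (h := g ∘ (e ⊕₁ e))); rewrite -!comp_assoc -Hx -Hy yx.
Qed.

Lemma doubling_endo_trivial (m : hom E (E ⊕ E)) (f : hom E E) :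
  (f ⊕₁ f) ∘ m = m ∘ f -> f = idm E.
Proof.
move=> H; have [x Hx] := transport_exists m.
have [z ze] : exists z : hom 0 0, z ∘ e = e ∘ f.
  by exists (e ∘ f ∘ bwd e); rewrite -!comp_assoc bwdK comp_idr.
have D : z ∘ z ∘ x ∘ e = x ∘ z ∘ e.
  rewrite ze (comp_under Hx) -!comp_assoc -H bmap_compA -ze bmap_comp.
  by rewrite -!comp_assoc (comp_under (endo_unit_tensor _ _)) -!comp_assoc Hx.
have z1 : z = idm 0.
  apply: (scg_epic (h := x ∘ e)); rewrite comp_idl; apply: (scg_monic (h := z)).
  by rewrite D !comp_assoc (endo_unit_comm x z).
by apply: (iso_monic (i := e)); rewrite -ze z1 comp_idl comp_idr.
Qed.

End Doubling.
End CategoricalGroup.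

(** * The braiding at the zero object *)

Lemma braid_zero (C : category) (oplus otimes : bifunctor C)
    (S : symmetric_categorical_group oplus) (M : symmetric_monoidal otimes)
    (L : left_distributivity oplus otimes)
    (R : right_distributivity oplus otimes) :
  lrdistr_braid M L R -> lrdistr_interchange S L R ->
  fwd (braid M (unit S) (unit S)) = idm (otimes (unit S) (unit S)).
Proof.
move=> LRc H.
set o := unit S; pose g := lunit S o.
(* [mL] and [mR] split the second and the first factor [o] as [o ⊕ o], then distribute. *)
pose mL : iso (otimes o o) _ :=
  iso_comp (L o o o) (bmap_iso otimes (iso_id o) (iso_sym g)).
pose mR : iso (otimes o o) _ :=
  iso_comp (R o o o) (bmap_iso otimes (iso_sym g) (iso_id o)).
have [e] := scg_iso_unit S mL.
have mLR : fwd mL = mR.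
  apply: (doubling_unique e); rewrite /mL /mR /= !bmap_comp.
  have := H o o o o; move: (interchange S) => w {}H.
  move: (bwd g) => b; have Rb := rdistr_nat R (idm o) (idm o) b.
  (* Naturality moves every [b] to the right, where both sides end in [b ⊗₁ b]; the rest is the
     interchange law at [o]. *)
  rewrite bmap_id in Rb; rewrite -!comp_assoc.
  rewrite (comp_under (esym (ldistr_natl L _ _ b))) (comp_under (esym Rb)).
  rewrite !comp_assoc -comp_assoc in H *; rewrite {}H.
  by rewrite -!comp_assoc -!bmap_comp !comp_idl !comp_idr.
apply: (doubling_endo_trivial e (m := mL)).
(* The braiding exchanges [mL] and [mR], so their equality makes it commute with doubling. *)
rewrite {2}mLR /mL /mR /= comp_assoc -LRc -!comp_assoc.
by rewrite braid_nat.
Qed.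

Theorem proposition6p3 (C : category) (oplus otimes : bifunctor C) :
  inhabited (symmetric_ann_category oplus otimes) <->
  exists (S : symmetric_categorical_group oplus)
         (M : symmetric_monoidal otimes)
         (L : left_distributivity oplus otimes),
    (forall A : C,
      @is_oplus_functor C oplus (left_functor otimes A) (L A) /\
      @compatible_assoc C oplus S (left_functor otimes A) (L A) /\
      @compatible_braid C oplus S (left_functor otimes A) (L A)) /\
    ldistr_assoc M L /\
    ldistr_unit M L /\
    ldistr_interchange S M L.
Proof.
split.
  case=> [[S M _ L R La Lb _ _ L1 _ _ L4 L51 _ LRc]]; exists S, M, L.
  (* For fixed [A] this is naturality of [L] at the identity of [A]. *)
  split; first by move=> A; split=> // X X' Y Y' f g; exact: ldistr_nat.
  by split=> //; split=> //; apply/(lrdistr_interchangeE S LRc).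
move=> [S [M [L [LA [L1 [L51 L8]]]]]].
pose R := rdistr_of M L.
have LRc : lrdistr_braid M L R := rdistr_of_braid M L.
have L4 : lrdistr_interchange S L R by apply/(lrdistr_interchangeE S LRc).
constructor; apply: (@SymmetricAnnCategory _ _ _ S M _ L R) => //.
- exact: braid_zero LRc L4.
- by move=> A; have [_ []] := LA A.
- by move=> A; have [_ []] := LA A.
- by move=> A; apply: (rdistr_compatible_assoc LRc); have [_ []] := LA A.
- by move=> A; apply: (rdistr_compatible_braid LRc); have [_ []] := LA A.
- exact: rdistr_assoc_of.
- exact: lrdistr_assoc_of.
- exact: rdistr_unit_of.
Qed.
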